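(* Let $L$ denote a one-dimensional finite difference interface layer with diagonal norm matrix $H_L$, $R$ a $\mathbb{P}^1$ finite element interface layer with (nondiagonal) norm matrix $\mathbf{M}_I$, and $M$ the middle layer having the same nodes as $R$ and the diagonal (lumped) norm matrix $H_M$. Assume that the diagonal-norm interpolation operators $I_{L2M}$ (from $L$ to $M$) and $I_{M2L}$ (from $M$ to $L$) satisfy (1) the accuracy requirement of order $p$: $u_M=I_{L2M}u_L+\mathcal{O}(h^p)$ and $u_L=I_{M2L}u_M+\mathcal{O}(h^p)$; (2) the SBP requirement $H_MI_{L2M}=I_{M2L}^TH_L$; (3) $H_L(I-I_{M2L}I_{L2M})\ge0$ and $H_M(I-I_{L2M}I_{M2L})\ge0$. Define $$I_{L2R}=I_{M2R}I_{L2M},\qquad I_{R2L}=I_{M2L}I_{R2M},\qquad\text{where } I_{M2R}=I \text{ (identity)},\quad I_{R2M}=(\mathbf{M}_IH_M^{-1})^T.$$ Then $\{I_{L2R},I_{R2L}\}$ is a pair of SBP-preserving interpolation operators, i.e. they satisfy the accuracy requirement $u_R=I_{L2R}u_L+\mathcal{O}(h^p)$, $u_L=I_{R2L}u_R+\mathcal{O}(h^p)$ and $$\mathbf{M}_II_{L2R}=I_{R2L}^TH_L.$$ Moreover they satisfy $$H_L(I-I_{R2L}I_{L2R})\ge0,\qquad \mathbf{M}_I(I-I_{L2R}I_{R2L})\ge0.$$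
   Context: All layers are node distributions on the same straight interface segment. $H_L$ is the diagonal positive definite norm matrix of a one-dimensional diagonal-norm summation-by-parts finite difference operator along the interface. $\mathbf{M}_I$ is the one-dimensional $\mathbb{P}^1$ mass matrix along the interface, $(\mathbf{M}_I)_{ij}=\int\psi_j\psi_i\,ds$, with $\psi_i$ the continuous piecewise linear nodal basis functions on the FE interface nodes. $H_M$ is the lumped mass matrix: the diagonal matrix whose diagonal entries are the row sums of $\mathbf{M}_I$ (on an equidistant distribution with step $h_y$ it is $h_y\,\mathrm{Diag}(1/2,1,\dots,1,1/2)$, the second-order diagonal-norm FD norm matrix). An inequality $B\ge0$ means that $B$ is symmetric positive semidefinite. In the accuracy requirements, $u_L,u_M,u_R$ are the restrictions of a smooth function to the nodes of the respective layer, $h$ is the mesh size, $\mathcal{O}(h^p)$ is understood in the discrete norm $\|w\|^2=w^THw$ of the target layer (with $H$ the norm matrix of that layer), and $p=\min(p_L,p_R)$ where $p_L,p_R$ are the orders of accuracy in the boundary closure of the two coupled methods (a $q$-th order narrow-stencil diagonal-norm FD operator has boundary closure order $q/2$; the $\mathbb{P}^1$ layer, corresponding to second-order FD, has $p_R=1$). *)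

(* Defs.v *)
From HB Require Import structures.
From mathcomp Require Import all_boot all_order all_algebra.
From mathcomp Require Import all_classical all_reals all_analysis.

Set Implicit Arguments.
Unset Strict Implicit.
Unset Printing Implicit Defensive.

Import Order.TTheory GRing.Theory Num.Theory.
Import numFieldNormedType.Exports.

Local Open Scope classical_set_scope.
Local Open Scope ring_scope.

(* Everything below is uniform in a refinement sequence: layers, norm matrices
   and operators are families indexed by k : nat, and O(h^p) is the Landau
   relation =O_\oo in k. *)

(* A strictly increasing node distribution with at least two nodes, end points
   included, on the interface segment [a, b]. *)
Record layer (R : realType) (a b : R) := Layer {
  nsub : nat;
  node : 'I_nsub.+2 -> R;
  node_lt : forall i j : 'I_nsub.+2, (i < j)%N -> node i < node j;
  node_first : node ord0 = a;
  node_last : node ord_max = b }.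

Notation nnodes l := (nsub l).+2.

(* The i-th of the nsub.+1 subintervals is [lnode l i, rnode l i]. *)
Definition lnode (R : realType) (a b : R) (l : layer a b)
  (i : 'I_(nsub l).+1) : R := node (widen_ord (leqnSn _) i).

Definition rnode (R : realType) (a b : R) (l : layer a b)
  (i : 'I_(nsub l).+1) : R := node (lift ord0 i).

Definition mesh_width (R : realType) (a b : R) (l : layer a b) : R :=
  \big[Num.max/0]_(i < (nsub l).+1) (rnode i - lnode i).

Definition mesh_size (R : realType) (a b : R) (L M : nat -> layer a b)
  (k : nat) : R := Num.max (mesh_width (L k)) (mesh_width (M k)).

Definition smooth (R : realType) (u : R -> R) : Prop :=
  forall (m : nat) (x : R), derivable (derive1n m u) x 1.

Definition restr (R : realType) (a b : R) (u : R -> R) (l : layer a b) :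
  'cV[R]_(nnodes l) := \col_i u (node i).

Definition psd (R : realType) (n : nat) (B : 'M[R]_n) : Prop :=
  B^T = B /\ forall w : 'cV[R]_n, 0 <= (w^T *m B *m w) 0 0.

Definition diag_posdef (R : realType) (n : nat) (H : 'M[R]_n) : Prop :=
  is_diag_mx H /\ forall i, 0 < H i i.

Definition dnorm (R : realType) (n : nat) (H : 'M[R]_n) (w : 'cV[R]_n) : R :=
  Num.sqrt ((w^T *m H *m w) 0 0).

(* u_T = I_{S2T} u_S + O(h^p) for every smooth u, in the norm of the target
   layer T. *)
Definition accurate (R : realType) (a b : R) (S T : nat -> layer a b)
    (HT : forall k, 'M[R]_(nnodes (T k)))
    (IS2T : forall k, 'M[R]_(nnodes (T k), nnodes (S k)))
    (h : nat -> R) (p : nat) : Prop :=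
  forall u : R -> R, smooth u ->
    (fun k => dnorm (HT k) (restr u (T k) - IS2T k *m restr u (S k)))
      =O_\oo (fun k => h k ^+ p).

(* The first and last r rows form the boundary closure. *)
Definition closure_row (n r : nat) (i : 'I_n) : bool :=
  (i < r)%N || (n - r <= i)%N.

(* The truncation error of D as an approximation of the m-th derivative is of
   order q at the interior nodes and of order pL in the boundary closure, whose
   size r does not depend on the mesh. *)
Definition fd_accurate (R : realType) (a b : R) (L : nat -> layer a b)
    (D : forall k, 'M[R]_(nnodes (L k))) (m q pL r : nat) : Prop :=
  forall u : R -> R, smooth u ->
    let err k := D k *m restr u (L k) - restr (derive1n m u) (L k) in
    (fun k => \big[Num.max/0]_(i | ~~ closure_row r i) `|err k i 0|)
      =O_\oo (fun k => mesh_width (L k) ^+ q) /\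
    (fun k => \big[Num.max/0]_(i | closure_row r i) `|err k i 0|)
      =O_\oo (fun k => mesh_width (L k) ^+ pL).

(* Diag(-1, 0, ..., 0, 1) *)
Definition boundary_mx (R : realType) (n : nat) : 'M[R]_n.+2 :=
  delta_mx ord_max ord_max - delta_mx ord0 ord0.

(* D = H^-1 Q with Q + Q^T = Diag(-1, 0, ..., 0, 1). *)
Definition sbp_first (R : realType) (a b : R) (L : nat -> layer a b)
    (H D : forall k, 'M[R]_(nnodes (L k))) : Prop :=
  forall k, H k *m D k + (H k *m D k)^T = boundary_mx R (nsub (L k)).

(* D = H^-1 (B S - A), A symmetric positive semidefinite,
   B = Diag(-1, 0, ..., 0, 1), where only the first and last rows of S matter:
   they approximate the first derivative at the two end points. *)
Definition sbp_second (R : realType) (a b : R) (L : nat -> layer a b)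
    (H D : forall k, 'M[R]_(nnodes (L k))) (pL : nat) : Prop :=
  exists A S : forall k, 'M[R]_(nnodes (L k)),
    (forall k, psd (A k) /\
       H k *m D k = boundary_mx R (nsub (L k)) *m S k - A k) /\
    forall u : R -> R, smooth u ->
      let err k := S k *m restr u (L k) - restr (derive1n 1 u) (L k) in
      (fun k => err k ord0 0) =O_\oo (fun k => mesh_width (L k) ^+ pL) /\
      (fun k => err k ord_max 0) =O_\oo (fun k => mesh_width (L k) ^+ pL).

(* H is the norm of a diagonal-norm SBP finite difference operator, for the
   first or the second derivative, of interior order q and boundary closure
   order pL.  The q-th order narrow-stencil second derivative operators are the
   instances with pL = q./2. *)
Definition diag_sbp_norm (R : realType) (a b : R) (L : nat -> layer a b)
    (H : forall k, 'M[R]_(nnodes (L k))) (q pL : nat) : Prop :=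
  (forall k, diag_posdef (H k)) /\
  exists (D : forall k, 'M[R]_(nnodes (L k))) (r : nat),
    (sbp_first H D /\ fd_accurate D 1 q pL r) \/
    (sbp_second H D pL /\ fd_accurate D 2 q pL r).

(* psi consists of the continuous piecewise linear functions on [a, b] that are
   nodal on l; this determines each psi i on [a, b]. *)
Definition p1_nodal_basis (R : realType) (a b : R) (l : layer a b)
    (psi : 'I_(nnodes l) -> R -> R) : Prop :=
  forall i,
    [/\ {within `[a, b], continuous (psi i)},
        forall e : 'I_(nsub l).+1, exists c d : R,
          forall s, lnode e <= s <= rnode e -> psi i s = c + d * s
      & forall j, psi i (node j) = (i == j)%:R].

Definition p1_mass (R : realType) (a b : R) (l : layer a b)
    (psi : 'I_(nnodes l) -> R -> R) : 'M[R]_(nnodes l) :=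
  \matrix_(i, j) \int[@lebesgue_measure R]_(s in `[a, b]) (psi j s * psi i s).

Definition lumped (R : realType) (n : nat) (M : 'M[R]_n) : 'M[R]_n :=
  diag_mx (\row_i \sum_j M i j).

(* Order of accuracy of the P1 layer in the boundary closure. *)
Definition p1_order : nat := 1.

(* Main.v *)
(** Write M for the P1 mass matrix and H for its lumping. As M is symmetric with
    nonnegative entries, 0 <= M <= H as quadratic forms, which also gives
    M H^-1 M <= M. The SBP identity turns the two semidefiniteness hypotheses
    into I_L2M^T H I_L2M <= H_L and I_M2L^T H_L I_M2L <= H; sandwiching with
    M <= H and M H^-1 M <= M yields the two conclusions. For accuracy, the i-th
    entry of H^-1 M u averages u over the i-th node and its neighbours, hence
    differs from u_i by O(h), and I_M2L does not increase norms. *)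

Require Import Defs.
From HB Require Import structures.
From mathcomp Require Import all_boot all_order all_algebra.
From mathcomp Require Import ring lra.
From mathcomp Require Import all_classical all_reals all_analysis.

Set Implicit Arguments.
Unset Strict Implicit.
Unset Printing Implicit Defensive.

Import Order.TTheory GRing.Theory Num.Theory.
Import numFieldNormedType.Exports.

Local Open Scope classical_set_scope.
Local Open Scope ring_scope.

(** * Quadratic forms and lumping *)

Definition quad (R : realType) (n : nat) (B : 'M[R]_n) (w : 'cV[R]_n) : R :=
  (w^T *m B *m w) 0 0.

Lemma quadE (R : realType) (n : nat) (B : 'M[R]_n) (w : 'cV[R]_n) :
  quad B w = \sum_i \sum_j B i j * w i 0 * w j 0.
Proof.
rewrite /quad mxE exchange_big; apply: eq_bigr => j _ /=.
by rewrite mxE mulr_suml; apply: eq_bigr => i _; rewrite !mxE (mulrC (w i 0)).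
Qed.

Lemma quadB (R : realType) (n : nat) (A B : 'M[R]_n) (w : 'cV[R]_n) :
  quad (A - B) w = quad A w - quad B w.
Proof. by rewrite /quad mulmxBr mulmxBl !mxE. Qed.

Lemma quad_congr (R : realType) (m n : nat) (B : 'M[R]_m) (P : 'M[R]_(m, n))
    (w : 'cV[R]_n) :
  quad (P^T *m B *m P) w = quad B (P *m w).
Proof. by rewrite /quad trmx_mul !mulmxA. Qed.

Lemma trmx_congr (R : realType) (m n : nat) (B : 'M[R]_m) (P : 'M[R]_(m, n)) :
  B^T = B -> (P^T *m B *m P)^T = P^T *m B *m P.
Proof. by move=> Bsym; rewrite !trmx_mul trmxK Bsym mulmxA. Qed.

Lemma quad_parallelogram (R : realType) (n : nat) (B : 'M[R]_n)
    (u v : 'cV[R]_n) :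
  quad B (u + v) + quad B (u - v) = 2 * quad B u + 2 * quad B v.
Proof.
rewrite /quad !linearD linearN /= !(mulmxDl, mulmxDr, mulNmx, mulmxN).
by rewrite !mxE; ring.
Qed.

(** Dropping [quad B (u - v)] from the parallelogram identity suffices; the factor 2 in this weak
    triangle inequality is harmless inside O(h^p) and spares Cauchy-Schwarz. *)
Lemma dnormD_le (R : realType) (n : nat) (B : 'M[R]_n) (u v : 'cV[R]_n) :
  (forall w, 0 <= quad B w) -> dnorm B (u + v) <= 2 * (dnorm B u + dnorm B v).
Proof.
move=> B0.
rewrite -ler_sqr ?nnegrE ?sqrtr_ge0 ?mulr_ge0 ?addr_ge0 ?sqrtr_ge0//.
have := quad_parallelogram B u v; have := B0 (u - v).
have := @sqr_sqrtr _ _ (B0 u); have := @sqr_sqrtr _ _ (B0 v).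
have := @sqr_sqrtr _ _ (B0 (u + v)).
rewrite /dnorm -!/(quad B _).
have := @sqrtr_ge0 _ (quad B u); have := @sqrtr_ge0 _ (quad B v).
nra.
Qed.

Lemma lumped_sym (R : realType) (n : nat) (M : 'M[R]_n) :
  (lumped M)^T = lumped M.
Proof. exact: tr_diag_mx. Qed.

Lemma mul_lumpedE (R : realType) (n : nat) (M : 'M[R]_n) (w : 'cV[R]_n) i :
  (lumped M *m w) i 0 = (\sum_j M i j) * w i 0.
Proof. by rewrite mul_diag_mx !mxE. Qed.

Lemma quad_lumped (R : realType) (n : nat) (M : 'M[R]_n) (w : 'cV[R]_n) :
  quad (lumped M) w = \sum_i \sum_j M i j * w i 0 ^+ 2.
Proof.
rewrite quadE; apply: eq_bigr => i _.
rewrite (bigD1 i)//= big1 ?addr0 => [|j /negPf ji]; last first.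
  by rewrite !mxE eq_sym ji mulr0n !mul0r.
by rewrite !mxE eqxx mulr1n -mulr_suml -mulrA expr2.
Qed.

(** Sum 2 w_i w_j <= w_i^2 + w_j^2 with the weights M_ij >= 0: by symmetry each of the two squares
    contributes one copy of the lumped form. *)
Lemma quad_le_lumped (R : realType) (n : nat) (M : 'M[R]_n) (w : 'cV[R]_n) :
  M^T = M -> (forall i j, 0 <= M i j) -> quad M w <= quad (lumped M) w.
Proof.
move=> Msym M0.
have E : quad (lumped M) w = \sum_i \sum_j M i j * w j 0 ^+ 2.
  rewrite quad_lumped exchange_big; apply: eq_bigr => i _; apply: eq_bigr => j _.
  by rewrite -{1}Msym mxE.
rewrite -(@ler_pM2l _ 2)// !mulr_natl mulr2n [leRHS]mulr2n {1}E quad_lumped.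
rewrite quadE -!big_split; apply: ler_sum => i _ /=.
rewrite -!big_split; apply: ler_sum => j _ /=.
have := mulr_ge0 (M0 i j) (sqr_ge0 (w i 0 - w j 0)).
lra.
Qed.

Lemma lumped_unit (R : realType) (n : nat) (M : 'M[R]_n) :
  (forall i, 0 < \sum_j M i j) -> lumped M \in unitmx.
Proof.
move=> M0; rewrite unitmxE det_diag unitfE; apply/prodf_neq0 => i _.
by rewrite mxE gt_eqF.
Qed.

(** * Interpolation operators *)

Section glue.
Variables (R : realType) (l m : nat) (HL : 'M[R]_l) (H M : 'M[R]_m).
Variables (IL2M : 'M[R]_(m, l)) (IM2L : 'M[R]_(l, m)).
Hypotheses (HLsym : HL^T = HL) (Hsym : H^T = H) (Msym : M^T = M).
Hypothesis Hunit : H \in unitmx.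
Hypothesis M_ge0 : forall w, 0 <= quad M w.
Hypothesis M_le_H : forall w, quad M w <= quad H w.
Hypothesis sbp : H *m IL2M = IM2L^T *m HL.

Let sbpT : HL *m IM2L = IL2M^T *m H.
Proof. by apply: trmx_inj; rewrite !trmx_mul trmxK HLsym Hsym sbp. Qed.

Let R2M : (M *m invmx H)^T = invmx H *m M.
Proof. by rewrite trmx_mul Msym trmx_inv Hsym. Qed.

(** Insert H^-1 H after M; the SBP identity then turns H I_L2M into I_M2L^T H_L. *)
Lemma sbp_R2L : M *m IL2M = (IM2L *m (M *m invmx H)^T)^T *m HL.
Proof. by rewrite trmx_mul trmxK -mulmxA -sbp mulmxA mulmxKV. Qed.

(** By the SBP identity, H I_L2M I_M2L = I_M2L^T H_L I_M2L, so the semidefiniteness hypothesis says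
    exactly that I_M2L is a contraction. This serves both the last inequality and the accuracy of
    I_R2L. *)
Lemma quad_IM2L_le (w : 'cV[R]_m) :
  psd (H *m (1%:M - IL2M *m IM2L)) -> quad HL (IM2L *m w) <= quad H w.
Proof.
move=> [_ /(_ w)]; rewrite mulmxBr mulmx1 mulmxA sbp -/(quad _ w) quadB.
by rewrite quad_congr subr_ge0.
Qed.

(** The lumped norm cancels: H_L I_M2L H^-1 M I_L2M = I_L2M^T M I_L2M. Replacing M by the larger H
    gives the form that the hypothesis bounds by H_L. *)
Lemma psd_L2R2L : psd (HL *m (1%:M - IM2L *m IL2M)) ->
  psd (HL *m (1%:M - IM2L *m (M *m invmx H)^T *m IL2M)).
Proof.
move=> [_ ps]; rewrite R2M mulmxBr mulmx1 !mulmxA sbpT mulmxK//.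
split=> [|w].
  by rewrite linearB /= trmx_congr// HLsym.
rewrite -/(quad _ w) quadB quad_congr subr_ge0 (le_trans (M_le_H _))//.
have := ps w; rewrite mulmxBr mulmx1 mulmxA sbpT -/(quad _ w) quadB.
by rewrite quad_congr subr_ge0.
Qed.

(* With v = H^-1 M w, the inequality M H^-1 M <= M is
   0 <= (w - v)^T M (w - v) + v^T (H - M) v. *)
Lemma quad_MHM_le (w : 'cV[R]_m) : quad H (invmx H *m M *m w) <= quad M w.
Proof.
set v := invmx H *m M *m w.
have Hv : H *m v = M *m w by rewrite /v !mulmxA mulmxV// mul1mx.
have vM : v^T *m H = w^T *m M.
  by apply: trmx_inj; rewrite !trmx_mul !trmxK Hsym Msym.
have vMw : v^T *m M *m w = v^T *m H *m v by rewrite -!mulmxA Hv.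
have wMv : w^T *m M *m v = v^T *m H *m v by rewrite vM.
have := M_ge0 (w - v); have := M_le_H v.
rewrite /quad !linearB /= !(mulmxBl, mulmxBr) vMw wMv.
by rewrite !mxE; lra.
Qed.

(** With P = I_R2L, [sbp_R2L] makes the subtracted term P^T H_L P; the contraction property of I_M2L
    and then [quad_MHM_le] bound it by M. *)
Lemma psd_R2L2R : psd (H *m (1%:M - IL2M *m IM2L)) ->
  psd (M *m (1%:M - IL2M *m (IM2L *m (M *m invmx H)^T))).
Proof.
move=> ps; set P := IM2L *m _.
have -> : M *m (1%:M - IL2M *m P) = M - P^T *m HL *m P.
  by rewrite mulmxBr mulmx1 mulmxA sbp_R2L.
split=> [|w].
  by rewrite linearB /= trmx_congr// Msym.
rewrite -/(quad _ w) quadB quad_congr subr_ge0.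
rewrite /P -mulmxA (le_trans (quad_IM2L_le _ ps))// R2M.
exact: quad_MHM_le.
Qed.

End glue.

Lemma Rintegral_sum (R : realType) (d : measure_display) (T : measurableType d)
    (mu : {measure set T -> \bar R}) (D : set T) (I : finType)
    (f : I -> T -> R) :
  measurable D -> (forall i, mu.-integrable D (EFin \o f i)) ->
  \int[mu]_(s in D) (\sum_i f i s) = \sum_i \int[mu]_(s in D) f i s.
Proof.
move=> mD fint; apply: EFin_inj; rewrite -sumEFin /Rintegral.
transitivity (\int[mu]_(s in D) \sum_i (f i s)%:E)%E.
  under [in RHS]eq_integral do rewrite sumEFin.
  rewrite fineK//; apply: integrable_fin_num => //.
  apply: eq_integrable (integrable_sum _ _ (fun i _ => fint i)) => // s _.
  by rewrite /= sumEFin.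
rewrite integral_sum//; apply: eq_bigr => i _.
by rewrite fineK//; exact: integrable_fin_num (fint i).
Qed.

(** * The P1 mass matrix *)

Section layer.
Variables (R : realType) (a b : R) (l : layer a b).
Implicit Types (e : 'I_(nsub l).+1) (i j : 'I_(nnodes l)).

Definition endpoint e i : bool :=
  (i == widen_ord (leqnSn _) e) || (i == lift ord0 e).

Lemma lnode_lt_rnode e : lnode e < rnode e.
Proof. by apply: node_lt; rewrite lift0. Qed.

Lemma node_le i j : (i <= j)%N -> node i <= node j.
Proof.
by rewrite leq_eqVlt => /predU1P[/val_inj->//|/node_lt/ltW].
Qed.

Lemma node_itv i : a <= node i <= b.
Proof.
apply/andP; split; [rewrite -[leLHS](node_first l)|rewrite -[leRHS](node_last l)].
  exact: node_le.
by apply: node_le; rewrite -ltnS ltn_ord.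
Qed.

Lemma mesh_width_ge e : rnode e - lnode e <= mesh_width l.
Proof. exact: (@le_bigmax _ _ _ _ (fun e => rnode e - lnode e)). Qed.

Lemma mesh_width_ge0 : 0 <= mesh_width l.
Proof.
by apply: le_trans (mesh_width_ge ord0); rewrite subr_ge0 ltW// lnode_lt_rnode.
Qed.

Lemma layer_lt : a < b.
Proof. by rewrite -[ltLHS](node_first l) -[ltRHS](node_last l) node_lt. Qed.

Lemma subinterval_itv e s : lnode e <= s <= rnode e -> a <= s <= b.
Proof.
move=> /andP[es se]; have /andP[al _] := node_itv (widen_ord (leqnSn _) e).
have /andP[_ rb] := node_itv (lift ord0 e).
by rewrite (le_trans al es) (le_trans se rb).
Qed.

Lemma subinterval_exists s :
  a <= s <= b -> exists e, lnode e <= s <= rnode e.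
Proof.
move=> /andP[sa sb]; have sm : s <= node (@ord_max (nsub l).+1).
  by rewrite node_last.
(* Take the first node j at or beyond s: the subinterval ending at j contains s by minimality, and j
   = 0 forces s = a. *)
case: (@arg_minnP _ _ (fun j : 'I_(nnodes l) => s <= node j) (fun j => val j) sm) => j sj jmin.
case: (unliftP ord0 j) => [e ej|j0].
  exists e; rewrite /rnode -ej sj andbT leNgt; apply/negP => /ltW /jmin.
  by rewrite ej /= /bump leq0n add1n ltnn.
have -> : s = a by apply/eqP; rewrite eq_le sa andbT -[leRHS](node_first l) -j0.
exists ord0; rewrite /lnode (_ : widen_ord _ _ = ord0); last exact: val_inj.
by rewrite node_first lexx -[leLHS](node_first l) node_le.
Qed.

Lemma endpoint_exists i : exists e, endpoint e i.
Proof.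
case: (unliftP ord0 i) => [e ->|->]; first by exists e; rewrite /endpoint eqxx orbT.
by exists ord0; rewrite /endpoint; apply/orP; left; apply/eqP/val_inj.
Qed.

Lemma endpoint_dist e i j : endpoint e i -> endpoint e j ->
  `|node i - node j| <= mesh_width l.
Proof.
have w0 := mesh_width_ge0; have := mesh_width_ge e.
have := lnode_lt_rnode e; rewrite /lnode /rnode => lr wd.
by do 2![move=> /orP[]/eqP->]; rewrite ?subrr ?normr0// ler_norml; lra.
Qed.

Section basis.
Variable psi : 'I_(nnodes l) -> R -> R.
Hypothesis basis : p1_nodal_basis psi.

(** An affine function is fixed by its values at the two end points, and nodality makes these 0 or
    1. *)
Lemma p1_basisE i e s : lnode e <= s <= rnode e ->
  psi i s = ((rnode e - s) * (i == widen_ord (leqnSn _) e)%:R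
             + (s - lnode e) * (i == lift ord0 e)%:R) / (rnode e - lnode e).
Proof.
move=> es; have lr := lnode_lt_rnode e; have [_ /(_ e)[c [d affine]] nodal] := basis i.
rewrite -!nodal -/(lnode e) -/(rnode e) !affine ?lexx ?(ltW lr)//.
by field; rewrite subr_eq0 gt_eqF.
Qed.

Lemma p1_basis_ge0 i s : a <= s <= b -> 0 <= psi i s.
Proof.
move=> /subinterval_exists[e /[dup] es /andP[ls sr]]; rewrite (p1_basisE _ es).
apply: divr_ge0; last by rewrite subr_ge0 ltW// lnode_lt_rnode.
by apply: addr_ge0; rewrite mulr_ge0// subr_ge0.
Qed.

Lemma p1_basis_eq0 i e s :
  ~~ endpoint e i -> lnode e <= s <= rnode e -> psi i s = 0.
Proof.
by rewrite negb_or => /andP[/negPf wi /negPf ri] /p1_basisE->; rewrite wi ri !mulr0 addr0 mul0r.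
Qed.

Lemma p1_basis_sum s : a <= s <= b -> \sum_i psi i s = 1.
Proof.
move=> /subinterval_exists[e es]; have lr := lnode_lt_rnode e.
rewrite (eq_bigr _ (fun i _ => p1_basisE i es)) -mulr_suml big_split/= -!mulr_sumr.
have delta k : \sum_i (i == k :> 'I_(nnodes l))%:R = 1 :> R.
  by rewrite (bigD1 k)//= eqxx big1 ?addr0// => i /negPf->.
by rewrite !delta !mulr1 addrA subrK divff// subr_eq0 gt_eqF.
Qed.

(* On the middle half of a subinterval both basis functions attached to its
   end points are at least 1/4. *)
Lemma p1_basis_ge i e s : endpoint e i ->
  3 * lnode e + rnode e <= 4 * s <= lnode e + 3 * rnode e ->
  4^-1 <= psi i s.
Proof.
have lr := lnode_lt_rnode e => ei /andP[ls sr].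
rewrite (@p1_basisE i e); last by apply/andP; split; lra.
rewrite ler_pdivlMr ?subr_gt0//.
have [/eqP wi|wi] := boolP (i == widen_ord (leqnSn _) e).
  by rewrite mulr1; case: eqP => _ /=; rewrite ?mulr1 ?mulr0; lra.
move: ei; rewrite /endpoint (negPf wi) /= => ->; rewrite mulr0 mulr1; lra.
Qed.

Lemma p1_basis_continuous i : {within `[a, b], continuous (psi i)}.
Proof. by have [] := basis i. Qed.

Lemma p1_basis_mul_integrable i j :
  (@lebesgue_measure R).-integrable `[a, b] (EFin \o (fun s => psi j s * psi i s)).
Proof.
apply: continuous_compact_integrable; first exact: segment_compact.
move=> x; apply: cvgM; exact: p1_basis_continuous.
Qed.

Lemma p1_mass_sym : (p1_mass psi)^T = p1_mass psi.
Proof.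
apply/matrixP => i j; rewrite !mxE; apply: eq_Rintegral => s _; exact: mulrC.
Qed.

Lemma p1_mass_ge0 i j : 0 <= p1_mass psi i j.
Proof.
rewrite mxE; apply: Rintegral_ge0 => s /=; rewrite in_itv/= => sab.
by rewrite mulr_ge0// p1_basis_ge0.
Qed.

(** If no subinterval has both nodes as end points, one factor of the integrand vanishes on each
    subinterval. The mass matrix is thus tridiagonal, which localizes the averaging by H^-1 M. *)
Lemma p1_mass_neq0 i j :
  p1_mass psi i j != 0 -> exists e, endpoint e i && endpoint e j.
Proof.
apply: contra_neqP => nij; rewrite mxE (@eq_Rintegral _ _ _ _ _ (cst 0)).
  by rewrite Rintegral_cst ?mul0r.
move=> s; rewrite inE/= in_itv/= => /subinterval_exists[e es].
case: (boolP (endpoint e i)) => [ei|/p1_basis_eq0->//]; last by rewrite mulr0.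
case: (boolP (endpoint e j)) => [ej|/p1_basis_eq0->//]; last by rewrite mul0r.
by case: nij; exists e; rewrite ei.
Qed.

(** The integral of psi_i^2 is bounded below by its part over the middle half [[x, y]] of an
    adjacent subinterval, where psi_i^2 >= 1/16. *)
Lemma p1_mass_diag_gt0 i : 0 < p1_mass psi i i.
Proof.
have [e ei] := endpoint_exists i; have lr := lnode_lt_rnode e.
pose x := (3 * lnode e + rnode e) / 4; pose y := (lnode e + 3 * rnode e) / 4.
have xy : x < y by rewrite /x /y; lra.
rewrite mxE; apply: (@lt_le_trans _ _ (4^-1 * 4^-1 * (y - x))).
  by rewrite mulr_gt0 ?subr_gt0// mulr_gt0.
have sub : `[x, y]%classic `<=` `[a, b]%classic.
  move=> s /=; rewrite !in_itv/= => /andP[xs sy]; apply: (@subinterval_itv e).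
  by apply/andP; split; move: xs sy; rewrite /x /y; lra.
have int := p1_basis_mul_integrable i i.
rewrite -lee_fin [leRHS]fineK; last by apply: integrable_fin_num int.
have le_sub : (\int[@lebesgue_measure R]_(s in `[x, y]) (psi i s * psi i s)%:E
    <= \int[@lebesgue_measure R]_(s in `[a, b]) (psi i s * psi i s)%:E)%E.
  apply: ge0_subset_integral => //; first exact: measurable_int int.
  by move=> s _; rewrite lee_fin -expr2 sqr_ge0.
apply: le_trans le_sub.
have -> : (4^-1 * 4^-1 * (y - x))%:E
    = (\int[@lebesgue_measure R]_(s in `[x, y]) (4^-1 * 4^-1)%:E)%E.
  by rewrite integral_cst//= lebesgue_measure_itv/= lte_fin xy -EFinB -EFinM.
apply: ge0_le_integral => //.
- exact: measurable_funS sub (measurable_int _ int).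
- move=> s /=; rewrite in_itv/= => /andP[xs sy]; rewrite lee_fin.
  have ge : 4^-1 <= psi i s.
    by apply: (p1_basis_ge ei); apply/andP; split; move: xs sy; rewrite /x /y; lra.
  by rewrite ler_pM.
Qed.

Lemma p1_mass_row_gt0 i : 0 < \sum_j p1_mass psi i j.
Proof.
rewrite (bigD1 i)//= ltr_wpDr ?p1_mass_diag_gt0//.
by apply: sumr_ge0 => j _; exact: p1_mass_ge0.
Qed.

(** The mass matrix is the Gram matrix of the basis in L^2; positivity and the total mass both
    follow from this form. *)
Lemma quad_p1_mass (w : 'cV[R]_(nnodes l)) :
  quad (p1_mass psi) w
    = \int[@lebesgue_measure R]_(s in `[a, b]) (\sum_i w i 0 * psi i s) ^+ 2.
Proof.
have int i j := p1_basis_mul_integrable i j.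
have intZ i j : (@lebesgue_measure R).-integrable `[a, b]
    (EFin \o (fun s => w i 0 * w j 0 * (psi j s * psi i s))).
  by apply: eq_integrable (integrableZl _ (w i 0 * w j 0) (int i j)).
have intS i : (@lebesgue_measure R).-integrable `[a, b]
    (EFin \o (fun s => \sum_j w i 0 * w j 0 * (psi j s * psi i s))).
  apply: eq_integrable (integrable_sum _ _ (fun j _ => intZ i j)) => // s _.
  by rewrite /= sumEFin.
rewrite quadE; transitivity (\int[@lebesgue_measure R]_(s in `[a, b])
    \sum_i \sum_j w i 0 * w j 0 * (psi j s * psi i s)).
  rewrite Rintegral_sum//; apply: eq_bigr => i _.
  rewrite Rintegral_sum//; apply: eq_bigr => j _.
  by rewrite RintegralZl// mxE -mulrA mulrC.
apply: eq_Rintegral => s _; rewrite expr2 mulr_suml; apply: eq_bigr => i _.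
by rewrite mulr_sumr; apply: eq_bigr => j _; ring.
Qed.

Lemma quad_p1_mass_ge0 w : 0 <= quad (p1_mass psi) w.
Proof. by rewrite quad_p1_mass Rintegral_ge0// => s _; exact: sqr_ge0. Qed.

Lemma p1_mass_sum : \sum_i \sum_j p1_mass psi i j = b - a.
Proof.
(* The vector of ones represents the constant function 1, by the partition of unity. *)
transitivity (quad (p1_mass psi) (const_mx 1)).
  rewrite quadE; apply: eq_bigr => i _; apply: eq_bigr => j _.
  by rewrite !mxE !mulr1.
rewrite quad_p1_mass (@eq_Rintegral _ _ _ _ _ (fun=> 1)) => [|s]; last first.
  rewrite inE/= in_itv/= => /p1_basis_sum sum1; under eq_bigr do rewrite mxE mul1r.
  by rewrite sum1 expr1n.
rewrite Rintegral_cst//= mul1r lebesgue_measure_itv/= lte_fin layer_lt.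
by rewrite -EFinB.
Qed.

(* H_i (v_i - u_i) = \sum_j M_ij (u_j - u_i) only involves neighbours of the
   i-th node. *)
Lemma R2M_error (u : R -> R) (C : R) :
  (forall x y, a <= x <= b -> a <= y <= b -> `|u x - u y| <= C * `|x - y|) ->
  dnorm (lumped (p1_mass psi))
    (restr u l - (p1_mass psi *m invmx (lumped (p1_mass psi)))^T *m restr u l)
  <= C * mesh_width l * Num.sqrt (b - a).
Proof.
move=> lip; set M := p1_mass psi; set H := lumped M; set v := _ *m restr u l.
have C0 : 0 <= C.
  have := lip a b; rewrite !lexx (ltW layer_lt) => /(_ isT isT) /(le_trans (normr_ge0 _)).
  by rewrite pmulr_lge0// normr_gt0 subr_eq0 lt_eqF// layer_lt.
have w0 := mesh_width_ge0.
have Hv : H *m v = M *m restr u l.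
  rewrite /v trmx_mul p1_mass_sym trmx_inv lumped_sym !mulmxA mulmxV ?mul1mx//.
  exact/lumped_unit/p1_mass_row_gt0.
have bound i : `|(restr u l - v) i 0| <= C * mesh_width l.
  have Mi := p1_mass_row_gt0 i.
  rewrite -(ler_pM2l Mi) -{1}(gtr0_norm Mi) -normrM [leRHS]mulr_suml.
  have -> : (\sum_j M i j) * (restr u l - v) i 0
      = \sum_j M i j * (u (node i) - u (node j)).
    have Hvi : (\sum_j M i j) * v i 0 = \sum_j M i j * restr u l j 0.
      by rewrite -mul_lumpedE Hv mxE.
    have -> : (restr u l - v) i 0 = u (node i) - v i 0.
      by rewrite [LHS]mxE [X in X + _]mxE [X in _ + X]mxE.
    rewrite mulrBr Hvi mulr_suml -sumrB; apply: eq_bigr => j _.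
    by rewrite [restr u l j 0]mxE mulrBr.
  apply: le_trans (ler_norm_sum _ _ _) _; apply: ler_sum => j _.
  rewrite normrM ger0_norm ?p1_mass_ge0//.
  have [->|/p1_mass_neq0[e /andP[ei ej]]] := eqVneq (M i j) 0; first by rewrite !mul0r.
  rewrite ler_wpM2l ?p1_mass_ge0// (le_trans (lip _ _ (node_itv _) (node_itv _)))//.
  by rewrite ler_wpM2l// (endpoint_dist ei ej).
(* The diagonal weights of H sum to b - a, so the uniform entrywise bound costs only the factor
   sqrt(b - a) in the norm. *)
rewrite -[C * _]ger0_norm ?mulr_ge0// -sqrtr_sqr -sqrtrM ?sqr_ge0//.
rewrite /dnorm -/(quad H _) ler_wsqrtr// /H quad_lumped -p1_mass_sum mulr_sumr.
apply: ler_sum => i _; rewrite mulr_sumr; apply: ler_sum => j _.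
rewrite mulrC ler_wpM2r ?p1_mass_ge0// -[leLHS]real_normK ?num_real//.
by rewrite ler_pXn2r ?nnegrE ?mulr_ge0.
Qed.

End basis.
End layer.

(** * Accuracy *)

Lemma smooth_lipschitz (R : realType) (a b : R) (u : R -> R) :
  a <= b -> smooth u ->
  exists2 C, 0 <= C & forall x y, a <= x <= b -> a <= y <= b ->
    `|u x - u y| <= C * `|x - y|.
Proof.
move=> ab su.
have du x : derivable u x 1 := su 0%N x.
have cont : {within `[a, b], continuous (fun x => `|derive1 u x|)}.
  move=> x; apply: cvg_norm; move: x.
  by apply: derivable_within_continuous => x _; exact: (su 1%N x).
have [c _ cmax] := EVT_max ab cont.
(* The Lipschitz constant is the maximum of |u'| on [a, b], attained at [c]; the mean value theorem
   does the rest. *)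
exists `|derive1 u c| => // x y.
wlog xy : x y / y <= x => [wl xab yab|].
  have [/wl|/ltW/wl] := leP y x; first exact.
  by rewrite distrC (distrC x); apply.
move=> /andP[_ xb] /andP[ay _].
have [||z zxy ->] := @MVT_segment _ u (derive1 u) y x xy.
- by move=> z _; rewrite derive1E; exact: derivableP.
- by apply: derivable_within_continuous => z _.
rewrite normrM ler_wpM2r// cmax//.
move: zxy; rewrite !in_itv/= => /andP[yz zx].
by rewrite (le_trans ay yz) (le_trans zx xb).
Qed.

Lemma mesh_size_ge0 (R : realType) (a b : R) (L M : nat -> layer a b) k :
  0 <= mesh_size L M k.
Proof. by rewrite le_max mesh_width_ge0. Qed.
(* The middle layer has the nodes of the finite element layer, so both are FE;
   they differ by their norm matrices HM and MI. *)
Theorem theoremA1 (R : realType) (a b : R)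
    (FD FE : nat -> layer a b) (q pL : nat)
    (HL : forall k, 'M[R]_(nnodes (FD k)))
    (psi : forall k, 'I_(nnodes (FE k)) -> R -> R)
    (IL2M : forall k, 'M[R]_(nnodes (FE k), nnodes (FD k)))
    (IM2L : forall k, 'M[R]_(nnodes (FD k), nnodes (FE k))) :
  let h := mesh_size FD FE in
  let p := minn pL p1_order in
  let MI := fun k => p1_mass (psi k) in
  let HM := fun k => lumped (MI k) in
  h @ \oo --> (0 : R) ->
  diag_sbp_norm HL q pL ->
  (forall k, p1_nodal_basis (psi k)) ->
  accurate HM IL2M h p ->
  accurate HL IM2L h p ->
  (forall k, HM k *m IL2M k = (IM2L k)^T *m HL k) ->
  (forall k, psd (HL k *m (1%:M - IM2L k *m IL2M k))) ->
  (forall k, psd (HM k *m (1%:M - IL2M k *m IM2L k))) ->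
  let IM2R := fun k => 1%:M : 'M[R]_(nnodes (FE k)) in
  let IR2M := fun k => (MI k *m invmx (HM k))^T in
  let IL2R := fun k => IM2R k *m IL2M k in
  let IR2L := fun k => IM2L k *m IR2M k in
  [/\ accurate MI IL2R h p /\ accurate HL IR2L h p,
      forall k, MI k *m IL2R k = (IR2L k)^T *m HL k,
      forall k, psd (HL k *m (1%:M - IR2L k *m IL2R k))
    & forall k, psd (MI k *m (1%:M - IL2R k *m IR2L k))].
Proof.
move=> h p MI HM h0 [HLdiag _] basis accL2M accM2L sbp psdL psdM IM2R IR2M IL2R IR2L.
have HLsym k : (HL k)^T = HL k.
  by have [/is_diag_mxP dg _] := HLdiag k; apply/matrixP => i j; rewrite mxE;
     have [->//|ij] := eqVneq i j; rewrite !dg// eq_sym.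
have HL0 k w : 0 <= quad (HL k) w.
  have [/diag_mxP[d dE] pos] := HLdiag k; rewrite quadE sumr_ge0// => i _.
  rewrite (bigD1 i)//= big1 ?addr0 => [|j ji].
    by rewrite -mulrA -expr2 mulr_ge0 ?sqr_ge0// ltW.
  by rewrite dE mxE eq_sym (negPf ji) mulr0n !mul0r.
have HMsym k : (HM k)^T = HM k := lumped_sym _.
have MIsym k : (MI k)^T = MI k := p1_mass_sym _.
have HMunit k : HM k \in unitmx := lumped_unit (p1_mass_row_gt0 (basis k)).
have MI0 k w : 0 <= quad (MI k) w := quad_p1_mass_ge0 (basis k) w.
have MIH k w : quad (MI k) w <= quad (HM k) w :=
  quad_le_lumped w (MIsym k) (p1_mass_ge0 (basis k)).
have L2R k : IL2R k = IL2M k by rewrite /IL2R /IM2R mul1mx.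
split; last 3 first.
- by move=> k; rewrite L2R; exact: sbp_R2L.
- by move=> k; rewrite L2R; exact: psd_L2R2L.
- by move=> k; rewrite L2R; exact: psd_R2L2R.
split=> u su.
  (* I_L2R equals I_L2M, and the M_I-norm is at most the H_M-norm, so the same constant works. *)
  have /eqO_exP[C C0 acc] := accL2M u su; apply/eqO_exP; exists C => //.
  near=> k; have : `|dnorm (HM k) (restr u (FE k) - IL2M k *m restr u (FD k))|
    <= C * `|h k ^+ p| by near: k.
  apply: le_trans; rewrite !ger0_norm ?sqrtr_ge0// L2R.
  by rewrite ler_wsqrtr//; exact: MIH.
have ab : a < b := layer_lt (FD 0%N).
have [K K0 lip] := smooth_lipschitz (ltW ab) su.
have /eqO_exP[C C0 acc] := accM2L u su; apply/eqO_exP.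
(* [C] bounds the error of I_M2L, [K * Num.sqrt (b - a)] that of the averaging I_R2M, and 2 comes
   from [dnormD_le]. *)
exists (2 * (C + K * Num.sqrt (b - a))).
  by rewrite mulr_gt0// ltr_wpDr// mulr_ge0// sqrtr_ge0.
near=> k.
have acck : `|dnorm (HL k) (restr u (FD k) - IM2L k *m restr u (FE k))|
  <= C * `|h k ^+ p| by near: k.
have hk0 : 0 <= h k := mesh_size_ge0 _ _ _.
have hk1 : h k <= 1.
  near: k; move/cvgrPdist_le: h0 => /(_ 1 ltr01); apply: filterS => k.
  by rewrite sub0r normrN; apply: le_trans; exact: ler_norm.
(* The averaging is only first-order accurate; this is enough because p <= 1 and eventually h <=
   1. *)
have hkp : h k <= h k ^+ p by rewrite -[leLHS]expr1 ler_wiXn2l// geq_minr.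
rewrite (ger0_norm (exprn_ge0 p hk0)) in acck *.
rewrite (ger0_norm (sqrtr_ge0 _)) in acck; rewrite (ger0_norm (sqrtr_ge0 _)).
(* Split the error into that of I_M2L and the image under I_M2L of that of I_R2M; the contraction
   property controls the latter. *)
have -> : restr u (FD k) - IR2L k *m restr u (FE k)
    = (restr u (FD k) - IM2L k *m restr u (FE k))
      + IM2L k *m (restr u (FE k) - IR2M k *m restr u (FE k)).
  by rewrite mulmxBr mulmxA addrA subrK.
apply: le_trans (dnormD_le _ _ (HL0 k)) _.
rewrite -mulrA ler_pM2l// mulrDl lerD//.
apply: (@le_trans _ _ (K * mesh_width (FE k) * Num.sqrt (b - a))).
  apply: le_trans (R2M_error (basis k) lip).
  by rewrite ler_wsqrtr//; exact: quad_IM2L_le (sbp k) _ (psdM k).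
rewrite mulrAC ler_wpM2l ?mulr_ge0 ?sqrtr_ge0//.
by apply: le_trans hkp; rewrite le_max lexx orbT.
Unshelve. all: by end_near.
Qed.
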